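(* Let $H\subseteq G$ be an inclusion of countable discrete groups, where $G$ is I.C.C. and $L(H)$ is irreducible in $L(G)$ (that is, $L(H)'\cap L(G)=\mathbb{C}1$). Then: (i) each $u\in\mathcal{ON}(L(H))$ has the form $w\lambda_g$ for some unitary $w\in L(H)$ and some $g\in\mathcal{ON}_G(H)$; (ii) each $u\in\mathcal{N}(L(H))$ has the form $w\lambda_g$ for some unitary $w\in L(H)$ and some $g\in\mathcal{N}_G(H)$.
   Context: $\lambda$ is the left regular representation of $G$ on $\ell^2(G)$, $\lambda_s\delta_t=\delta_{st}$; $L(G)$ is the von Neumann algebra generated by $\{\lambda_g:g\in G\}$, and $L(H)\subseteq L(G)$ is the von Neumann subalgebra generated by $\{\lambda_h:h\in H\}$. I.C.C. means every conjugacy class other than that of $e$ is infinite. Normalizers: $\mathcal{N}(L(H))=\{u\in L(G)\text{ unitary}:uL(H)u^*=L(H)\}$ and $\mathcal{ON}(L(H))=\{u\in L(G)\text{ unitary}:uL(H)u^*\subseteq L(H)\}$. At the group level, $\mathcal{N}_G(H)=\{g\in G:gHg^{-1}=H\}$ and $\mathcal{ON}_G(H)=\{g\in G:gHg^{-1}\subseteq H\}$. *)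

(* Defs.v *)
From HB Require Import structures.
From mathcomp Require Import all_boot all_order all_algebra.
From mathcomp Require Import all_classical all_reals.
From mathcomp Require Import ereal esum numfun.
From mathcomp Require Import complex.
From mathcomp Require Import ring.

Set Implicit Arguments.
Unset Strict Implicit.
Unset Printing Implicit Defensive.

Import Order.TTheory GRing.Theory Num.Theory.

Local Open Scope classical_set_scope.
Local Open Scope ring_scope.

(* {pred} is boolean, so that the subtype below inherits its algebraic
   structure from the library; [R[i]^o] is R[i] as a vector space over itself. *)
Definition square_summable (R : realType) (I : choiceType) :
    {pred I -> R[i]^o} :=
  [pred f | `[< summable [set: I] (fun t => (Normc.normc (f t) ^+ 2)%:E) >]].

Section SquareSummable.
Variables (R : realType) (I : choiceType).
Implicit Types f g : I -> R[i]^o.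

Lemma square_summableP f :
  reflect (\esum_(t in [set: I]) (Normc.normc (f t) ^+ 2)%:E < +oo)%E
          (f \in @square_summable R I).
Proof.
rewrite inE /=; apply: (equivP (asboolP _)); rewrite /summable.
rewrite (@eq_esum _ _ _ _ (fun t => (Normc.normc (f t) ^+ 2)%:E))//.
by move=> t _; rewrite gee0_abs// lee_fin sqr_ge0.
Qed.

Lemma sqr_normcD (x y : R[i]) :
  Normc.normc (x + y) ^+ 2 <= 2 * (Normc.normc x ^+ 2 + Normc.normc y ^+ 2).
Proof.
have normc_ge0 (z : R[i]) : 0 <= Normc.normc z.
  by case: z => a b; exact: sqrtr_ge0.
apply: (@le_trans _ _ ((Normc.normc x + Normc.normc y) ^+ 2)).
  by rewrite ler_sqr ?nnegrE ?addr_ge0 ?normc_ge0//; exact: le_normcD.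
rewrite -subr_ge0 [leRHS](_ : _ = (Normc.normc x - Normc.normc y) ^+ 2).
  exact: sqr_ge0.
by ring.
Qed.

Lemma square_summable_submod : submod_closed (@square_summable R I).
Proof.
have nn f t : (0 <= (Normc.normc (f t) ^+ 2)%:E)%E by rewrite lee_fin sqr_ge0.
have sD f g : f \in @square_summable R I -> g \in @square_summable R I ->
    f + g \in @square_summable R I.
  move=> /square_summableP sf /square_summableP sg; apply/square_summableP.
  apply: (@le_lt_trans _ _ (\esum_(t in [set: I])
     (((Normc.normc (f t) ^+ 2)%:E + (Normc.normc (g t) ^+ 2)%:E) +
      ((Normc.normc (f t) ^+ 2)%:E + (Normc.normc (g t) ^+ 2)%:E)))%E).
    apply: le_esum => t _; rewrite -!EFinD lee_fin.
    by rewrite (le_trans (sqr_normcD _ _))// mulr_natl mulr2n.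
  by rewrite !esumD// ?lte_add_pinfty// => t _; rewrite adde_ge0.
have sZ a f : f \in @square_summable R I -> a *: f \in @square_summable R I.
  move=> /square_summableP sf; apply/square_summableP.
  have a0 : (0 <= (Normc.normc a ^+ 2)%:E)%E by rewrite lee_fin sqr_ge0.
  apply: (@le_lt_trans _ _ ((Normc.normc a ^+ 2)%:E *
      \esum_(t in [set: I]) (Normc.normc (f t) ^+ 2)%:E)%E); last first.
    by rewrite lte_mul_pinfty.
  apply: ge_ereal_sup => _ [A finA <-].
  rewrite (@eq_fsbigr _ _ _ _ _ (fun t => (Normc.normc a ^+ 2)%:E *
      (Normc.normc (f t) ^+ 2)%:E)%E); last first.
    move=> t _; rewrite -EFinM -exprMn -Normc.normcM.
    by [].
  rewrite -ge0_mule_fsumr; last by move=> t; exact: nn.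
  apply: lee_wpmul2l => //.
  by apply: ereal_sup_ubound; exists A.
split=> [|a f g sf sg]; last exact/sD/sg/sZ.
apply/square_summableP; rewrite esum1 ?ltry// => t _.
by rewrite Normc.normc0 expr0n.
Qed.

End SquareSummable.

HB.instance Definition _ (R : realType) (I : choiceType) :=
  GRing.isSubmodClosed.Build R[i] (I -> R[i]^o) (@square_summable R I)
    (@square_summable_submod R I).

Record ell2 (R : realType) (I : choiceType) := Ell2 {
  ell2_fun :> I -> R[i]^o ;
  ell2_funP : ell2_fun \in @square_summable R I }.

HB.instance Definition _ (R : realType) (I : choiceType) :=
  [isSub for @ell2_fun R I].
HB.instance Definition _ (R : realType) (I : choiceType) :=
  [Choice of ell2 R I by <:].
HB.instance Definition _ (R : realType) (I : choiceType) :=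
  [SubChoice_isSubLmodule of ell2 R I by <:].

Section HilbertSpace.
Variables (R : realType) (I : choiceType).
Local Notation H := (ell2 R I).
Implicit Types (x y : H) (u v : H -> H) (S M : set (H -> H)).

(* Unordered sum of an absolutely summable family; [esum] is only meaningful
   for nonnegative families. *)
Definition rsum (f : I -> R) : R :=
  fine (\esum_(t in [set: I]) (EFin \o f)^\+ t)%E -
  fine (\esum_(t in [set: I]) (EFin \o f)^\- t)%E.

Definition csum (f : I -> R[i]) : R[i] :=
  Complex (rsum (fun t => complex.Re (f t))) (rsum (fun t => complex.Im (f t))).

Definition dot x y : R[i] := csum (fun t => (x t : R[i]) * conjc (y t)).

Definition norm2 x : R :=
  Num.sqrt (fine (\esum_(t in [set: I]) (Normc.normc (x t) ^+ 2)%:E)%E).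

Definition bounded_op u : Prop :=
  linear u /\ exists C : R, forall x, norm2 (u x) <= C * norm2 x.

(* The adjoint exists (and is unique) when [u] is bounded; it is only used for
   such [u], and the default value 0 is then never taken. *)
Definition adj u : H -> H :=
  fun y => xget 0 [set z | forall x, dot (u x) y = dot x z].

Definition commutant S : set (H -> H) :=
  [set v | bounded_op v /\ forall u, S u -> u \o v = v \o u].

(* M = M'' forces M to be a unital subalgebra of B(H). *)
Definition von_neumann_algebra M : Prop :=
  [/\ M `<=` bounded_op,
      (forall u, M u -> M (adj u)) &
      M = commutant (commutant M)].

Definition vN_generated S : set (H -> H) :=
  \bigcap_(M in [set M | von_neumann_algebra M /\ S `<=` M]) M.

Definition scalar_ops : set (H -> H) :=
  [set u | exists c : R[i], u = (fun x => c *: x)].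

Definition unitary u : Prop := adj u \o u = id /\ u \o adj u = id.

Definition conj_by u S : set (H -> H) := [set u \o v \o adj u | v in S].

(* For N a subset of M. *)
Definition normalizer M N : set (H -> H) :=
  [set u | [/\ M u, unitary u & conj_by u N = N]].

Definition one_sided_normalizer M N : set (H -> H) :=
  [set u | [/\ M u, unitary u & conj_by u N `<=` N]].

End HilbertSpace.

Section Group.
Variable G : groupType.
Local Open Scope group_scope.

Definition icc : Prop :=
  forall g : G, g <> 1 -> infinite_set [set g ^ h | h in [set: G]].

Definition group_normalizer (H : set G) : set G :=
  [set g | [set g * h * g^-1 | h in H] = H].

Definition group_one_sided_normalizer (H : set G) : set G :=
  [set g | [set g * h * g^-1 | h in H] `<=` H].

End Group.

Section RegularRepresentation.
Variables (R : realType) (G : groupType).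

Lemma translate_square_summable (s : G) (x : ell2 R G) :
  (fun t => x (s^-1 * t)%g) \in @square_summable R G.
Proof.
apply/square_summableP; have /square_summableP := ell2_funP x.
rewrite (reindex_esum [set: G] [set: G] (fun t => s^-1 * t)%g)//.
split=> // [t t' _ _ /mulgI //|t _]; exists (s * t)%g => //.
by rewrite mulKg.
Qed.

Definition lambda (s : G) : ell2 R G -> ell2 R G :=
  fun x => Ell2 (translate_square_summable s x).

Lemma delta_square_summable (t : G) :
  (fun r => ((r == t)%:R : R[i])) \in @square_summable R G.
Proof.
apply/square_summableP.
rewrite (esumID [set t])//; last by move=> r _; rewrite lee_fin sqr_ge0.
rewrite !setTI esum_set1 ?lee_fin ?sqr_ge0//= esum1 ?adde0 ?ltry// => r /= rt.
by rewrite (negbTE (introN eqP rt)) Normc.normc0 expr0n.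
Qed.

Definition delta (t : G) : ell2 R G := Ell2 (delta_square_summable t).

Lemma lambda_delta (s t : G) : lambda s (delta t) = delta (s * t)%g.
Proof.
apply: val_inj; apply/funext => r /=; congr (nat_of_bool _)%:R.
by apply/eqP/eqP => [<-|->]; rewrite ?mulKg ?mulVKg.
Qed.

(* L(H), acting on ell2(G). *)
Definition group_vN (H : set G) : set (ell2 R G -> ell2 R G) :=
  vN_generated [set lambda h | h in H].

End RegularRepresentation.

Arguments lambda R {G} s.
Arguments group_vN R {G} H.

(* Main.v *)
(* Put xi = u delta_1, and let p be the restriction of functions to a right coset
   H g. For h in H the unitary u lambda_h u^* lies in L(H), hence commutes with
   p, and it maps xi to a right translate of xi. So the mass of xi on H g h does
   not depend on h; if it is positive then H g has a finite orbit under H, that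
   is, H0 = H \cap g^-1 H g has finite index in H. The vector u^* (p xi) is
   constant on H0-conjugacy classes. Irreducibility makes the nontrivial H-classes
   infinite, so this vector is a multiple of delta_1 and xi is supported on H g.
   Then u lambda_g^-1 is an element of L(G) supported on H, hence lies in L(H).
   Bounded operators have adjoints because the candidate for u^* y is given by
   its coefficients <y, u delta_r>, whose finite square sums are bounded. *)
Require Import Defs.
From mathcomp Require Import all_boot all_order all_algebra.
From mathcomp Require Import all_classical all_reals.
From mathcomp Require Import ereal esum numfun.
From mathcomp Require Import complex ring lra.

Set Implicit Arguments.
Unset Strict Implicit.
Unset Printing Implicit Defensive.

Import Order.TTheory GRing.Theory Num.Theory.

Local Open Scope classical_set_scope.
Local Open Scope ring_scope.

(** * Unordered sums of real families *)

Section RealSums.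
Variables (R : realType) (I : choiceType).
Implicit Types (a b f g : I -> R).

Definition rsummable f := summable [set: I] (EFin \o f).

Lemma ge0_esum_fin_num a : (forall t, 0 <= a t) -> rsummable a ->
  (\esum_(t in [set: I]) (a t)%:E)%E \is a fin_num.
Proof.
move=> a0; rewrite /rsummable summableE (@eq_esum _ _ _ _ (fun t => (a t)%:E))//.
by move=> t _; rewrite gee0_abs ?lee_fin.
Qed.

Lemma rsummable_le f g : (forall t, `|f t| <= g t) -> rsummable g -> rsummable f.
Proof.
move=> fg sg; apply: le_lt_trans sg; apply: le_esum => t _ /=; rewrite lee_fin.
exact: le_trans (fg t) (ler_norm _).
Qed.

Lemma rsummableD f g : rsummable f -> rsummable g -> rsummable (fun t => f t + g t).
Proof. exact: summableD. Qed.

Lemma rsummableN f : rsummable f -> rsummable (fun t => - f t).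
Proof. by rewrite /rsummable summableN. Qed.

Lemma ge0_esumZ (c : R) a : 0 <= c -> (forall t, 0 <= a t) ->
  (\esum_(t in [set: I]) (c * a t)%:E = c%:E * \esum_(t in [set: I]) (a t)%:E)%E.
Proof.
move=> c0 a0; rewrite /esum -ereal_supZl//; last first.
  apply/set0P; exists (\sum_(x \in set0) (a x)%:E)%E.
  by exists set0 => //; exact: fsets_set0.
congr ereal_sup; apply/seteqP; split=> x /=.
  move=> [A finA <-]; exists (\sum_(x \in A) (a x)%:E)%E; first by exists A.
  by rewrite ge0_mule_fsumr// => t; rewrite lee_fin.
move=> [_ [A finA <-] <-]; exists A => //.
by rewrite ge0_mule_fsumr// => t; rewrite lee_fin.
Qed.

Lemma rsummableZ (c : R) f : rsummable f -> rsummable (fun t => c * f t).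
Proof.
rewrite /rsummable /summable => sf.
rewrite (@eq_esum _ _ _ _ (fun t => (`|c| * `|f t|)%:E)); last first.
  by move=> t _ /=; rewrite normrM.
by rewrite ge0_esumZ// lte_mul_pinfty.
Qed.

(** Any splitting of [f] as a difference of summable nonnegative families gives the same value, so
    linearity can be proved without computing positive and negative parts. *)
Lemma rsum_sub f a b : (forall t, 0 <= a t) -> (forall t, 0 <= b t) ->
  rsummable a -> rsummable b -> (forall t, f t = a t - b t) ->
  rsum f = fine (\esum_(t in [set: I]) (a t)%:E)%E -
           fine (\esum_(t in [set: I]) (b t)%:E)%E.
Proof.
move=> a0 b0 sa sb fE.
have fab : EFin \o f = ((EFin \o a) \- (EFin \o b))%E.
  by apply/funext => t /=; rewrite fE.
have sf : summable [set: I] (EFin \o f) by rewrite fab; exact: summableB.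
have sP : (\esum_(t in [set: I]) (EFin \o f)^\+ t)%E \is a fin_num.
  have := @summable_funepos _ _ [set: I] _ sf.
  rewrite summableE (@eq_esum _ _ _ _ (EFin \o f)^\+%E)//.
  by move=> t _; rewrite gee0_abs.
have sN : (\esum_(t in [set: I]) (EFin \o f)^\- t)%E \is a fin_num.
  have := @summable_funeneg _ _ [set: I] _ sf.
  rewrite summableE (@eq_esum _ _ _ _ (EFin \o f)^\-%E)//.
  by move=> t _; rewrite gee0_abs.
apply: EFin_inj; rewrite /rsum !EFinB !fineK ?ge0_esum_fin_num// fab.
by rewrite esumB// => t _ /=; rewrite lee_fin.
Qed.

Lemma ge0_rsum a : (forall t, 0 <= a t) -> rsummable a ->
  rsum a = fine (\esum_(t in [set: I]) (a t)%:E)%E.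
Proof.
move=> a0 sa; have s0 : rsummable (fun _ : I => 0 : R).
  by apply: rsummable_le sa => t; rewrite normr0.
rewrite (rsum_sub a0 _ sa s0)//; last by move=> t; rewrite subr0.
by rewrite [X in _ - fine X]esum1// subr0.
Qed.

Lemma rsumB_ge0 f a b : (forall t, 0 <= a t) -> (forall t, 0 <= b t) ->
  rsummable a -> rsummable b -> (forall t, f t = a t - b t) ->
  rsum f = rsum a - rsum b.
Proof. by move=> *; rewrite (@rsum_sub f a b)// !ge0_rsum. Qed.

Lemma ge0_rsumD a b : (forall t, 0 <= a t) -> (forall t, 0 <= b t) ->
  rsummable a -> rsummable b -> rsum (fun t => a t + b t) = rsum a + rsum b.
Proof.
move=> a0 b0 sa sb; rewrite !ge0_rsum//; last 2 first.
  by move=> t; rewrite addr_ge0.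
  exact: rsummableD.
rewrite -fineD ?ge0_esum_fin_num// -esumD//; last 2 first.
by move=> t _; rewrite lee_fin.
by move=> t _; rewrite lee_fin.
Qed.

Lemma rsummable_pos f : rsummable f -> rsummable (fun t => Num.max (f t) 0).
Proof.
move=> sf; apply: (@rsummable_le _ (fun t => `|f t|)).
  by move=> t; rewrite ger0_norm ?le_max ?lexx ?orbT// ge_max normr_ge0 ler_norm.
apply: le_lt_trans sf; apply: le_esum => t _ /=.
by rewrite normr_id.
Qed.

Lemma max0_sub (x : R) : x = Num.max x 0 - Num.max (- x) 0.
Proof.
by case: (leP 0 x) => x0; case: (leP 0 (- x)) => x0'; lra.
Qed.

Lemma rsum_pos_neg f : rsummable f ->
  rsum f = rsum (fun t => Num.max (f t) 0) - rsum (fun t => Num.max (- f t) 0).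
Proof.
have m0 (x : R) : 0 <= Num.max x 0 by rewrite le_max lexx orbT.
move=> sf; apply: rsumB_ge0 => //; first exact: rsummable_pos.
  exact/rsummable_pos/rsummableN.
by move=> t; exact: max0_sub.
Qed.

(** Positive parts add up, and so do negative parts. The result is a splitting of [f + g] that need
    not be the one into its positive and negative parts, hence the appeal to [rsumB_ge0]. *)
Lemma rsumD f g : rsummable f -> rsummable g ->
  rsum (fun t => f t + g t) = rsum f + rsum g.
Proof.
have m0 (x : R) : 0 <= Num.max x 0 by rewrite le_max lexx orbT.
move=> sf sg; rewrite (rsum_pos_neg sf) (rsum_pos_neg sg) addrACA -opprD.
have [sfp sgp] := (rsummable_pos sf, rsummable_pos sg).
have [sfn sgn] := (rsummable_pos (rsummableN sf), rsummable_pos (rsummableN sg)).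
rewrite -!ge0_rsumD//; apply: rsumB_ge0 => //.
- by move=> t; rewrite addr_ge0.
- by move=> t; rewrite addr_ge0.
- exact: rsummableD.
- exact: rsummableD.
- by move=> t; rewrite {1}(max0_sub (f t)) {1}(max0_sub (g t)) addrACA -opprD.
Qed.

Lemma eq_rsum f g : f =1 g -> rsum f = rsum g.
Proof. by move=> /funext ->. Qed.

Lemma rsumN f : rsum (fun t => - f t) = - rsum f.
Proof.
rewrite /rsum opprB; congr (fine _ - fine _); apply: eq_esum => t _.
  by rewrite funeposE funenegE.
by rewrite funeposE funenegE/= opprK.
Qed.

Lemma rsumZ (c : R) f : rsummable f -> rsum (fun t => c * f t) = c * rsum f.
Proof.
have m0 (x : R) : 0 <= Num.max x 0 by rewrite le_max lexx orbT.
(* A negative [c] is reduced to [- c] by writing [c * f t] as [- (- c * f t)]. *)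
move=> sf; wlog c0 : c / 0 <= c.
  move=> H; case: (leP 0 c) => c0; first exact: H.
  rewrite (@eq_rsum _ (fun t => - (- c * f t))); last by move=> t; rewrite mulNr opprK.
  by rewrite rsumN H ?oppr_ge0 1?ltW// mulNr opprK.
have sfp := rsummable_pos sf; have sfn := rsummable_pos (rsummableN sf).
have pZ a : (forall t, 0 <= a t) -> rsummable a ->
    rsum (fun t => c * a t) = c * rsum a.
  move=> a0 sa; rewrite !ge0_rsum//; last 2 first.
    by move=> t; rewrite mulr_ge0.
    exact: rsummableZ.
  by rewrite ge0_esumZ// fineM// ge0_esum_fin_num.
rewrite [in RHS]rsum_pos_neg// mulrBr -!pZ//; apply: rsumB_ge0.
- by move=> t; rewrite mulr_ge0.
- by move=> t; rewrite mulr_ge0.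
- exact: rsummableZ.
- exact: rsummableZ.
- by move=> t; rewrite -mulrBr -max0_sub.
Qed.

Lemma reindex_rsum (e : I -> I) f : bijective e -> rsum (f \o e) = rsum f.
Proof.
move=> be; have eb : set_bij [set: I] [set: I] e by rewrite setTT_bijective.
by rewrite /rsum; congr (fine _ - fine _); rewrite [RHS](@reindex_esum _ _ _ _ _ _ _ eb);
  apply: eq_esum => t _; rewrite ?funeposE ?funenegE.
Qed.

Lemma rsum_single (s : I) f : (forall t, t != s -> f t = 0) -> rsum f = f s.
Proof.
move=> f0; have E (h : I -> \bar R) : (forall t, 0 <= h t)%E ->
    (forall t, t != s -> h t = 0%E) -> (\esum_(t in [set: I]) h t = h s)%E.
  move=> h0 hs; rewrite (esumID [set s])// !setTI esum_set1// esum1 ?adde0//.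
  by move=> t /= /eqP; exact: hs.
rewrite /rsum !E//; last 2 first.
- by move=> t ts; rewrite funenegE/= f0// oppr0 maxxx.
- by move=> t ts; rewrite funeposE/= f0// maxxx.
rewrite funeposE funenegE -[(EFin \o f) s]/((f s)%:E) [RHS]max0_sub.
by rewrite -EFinN -!EFin_max.
Qed.

End RealSums.

(** * Absolutely summable complex families *)

Section ComplexSums.
Variables (R : realType) (I : choiceType).
Implicit Types f g : I -> R[i].

Lemma normc_ge0 (z : R[i]) : 0 <= Normc.normc z.
Proof. by case: z => a b; exact: sqrtr_ge0. Qed.

Lemma conjcD (z w : R[i]) : conjc (z + w) = conjc z + conjc w.
Proof. exact: rmorphD. Qed.

Lemma conjcB (z w : R[i]) : conjc (z - w) = conjc z - conjc w.
Proof. exact: rmorphB. Qed.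

Lemma conjcM (z w : R[i]) : conjc (z * w) = conjc z * conjc w.
Proof. exact: rmorphM. Qed.

Lemma normcJ (z : R[i]) : Normc.normc (conjc z) = Normc.normc z.
Proof. by case: z => a b /=; rewrite sqrrN. Qed.

Lemma mulcJ (z : R[i]) : z * conjc z = (Normc.normc z ^+ 2)%:C%C.
Proof.
case: z => a b; rewrite /= sqr_sqrtr ?addr_ge0 ?sqr_ge0//.
by apply/eqP; rewrite eq_complex /=; apply/andP; split; apply/eqP; ring.
Qed.

Lemma Re_le_normc (z : R[i]) : `|complex.Re z| <= Normc.normc z.
Proof.
case: z => a b /=; rewrite -sqrtr_sqr ler_sqrt ?lerDl ?sqr_ge0//.
by rewrite addr_ge0 ?sqr_ge0.
Qed.

Lemma Im_le_normc (z : R[i]) : `|complex.Im z| <= Normc.normc z.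
Proof.
case: z => a b /=; rewrite -sqrtr_sqr ler_sqrt ?lerDr ?sqr_ge0//.
by rewrite addr_ge0 ?sqr_ge0.
Qed.

Definition csummable f := rsummable (fun t => Normc.normc (f t)).

Lemma csummable_Re f : csummable f -> rsummable (fun t => complex.Re (f t)).
Proof. by apply: rsummable_le => t; exact: Re_le_normc. Qed.

Lemma csummable_Im f : csummable f -> rsummable (fun t => complex.Im (f t)).
Proof. by apply: rsummable_le => t; exact: Im_le_normc. Qed.

Lemma eq_csum f g : f =1 g -> csum f = csum g.
Proof. by move=> /funext ->. Qed.

Lemma csumD f g : csummable f -> csummable g ->
  csum (fun t => f t + g t) = csum f + csum g.
Proof.
move=> sf sg; rewrite /csum.
rewrite (@eq_rsum _ _ _ (fun t => complex.Re (f t) + complex.Re (g t))).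
  rewrite (@eq_rsum _ _ (fun t => complex.Im (f t + g t))
    (fun t => complex.Im (f t) + complex.Im (g t))).
    by rewrite !rsumD//; [exact: csummable_Im|exact: csummable_Im
                         |exact: csummable_Re|exact: csummable_Re].
  by move=> t; case: (f t) (g t) => a b [c d].
by move=> t; case: (f t) (g t) => a b [c d].
Qed.

Lemma csumZ (c : R[i]) f : csummable f -> csum (fun t => c * f t) = c * csum f.
Proof.
move=> sf; have [sR sI] := (csummable_Re sf, csummable_Im sf).
case: c => a b; rewrite /csum.
rewrite (@eq_rsum _ _ _ (fun t => a * complex.Re (f t) + (- b) * complex.Im (f t))).
  rewrite (@eq_rsum _ _ (fun t => complex.Im (Complex a b * f t))
      (fun t => a * complex.Im (f t) + b * complex.Re (f t))).
    rewrite !rsumD ?rsumZ//; try exact: rsummableZ.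
    by rewrite mulNr.
  by move=> t; case: (f t).
by move=> t; case: (f t) => x y /=; rewrite mulNr.
Qed.

Lemma csumJ f : csum (fun t => conjc (f t)) = conjc (csum f).
Proof.
rewrite /csum /=; congr Complex; first by apply: eq_rsum => t; case: (f t).
by rewrite -rsumN; apply: eq_rsum => t; case: (f t).
Qed.

Lemma reindex_csum (e : I -> I) f : bijective e -> csum (f \o e) = csum f.
Proof.
move=> be; rewrite /csum -(reindex_rsum (fun t => complex.Re (f t)) be).
by rewrite -(reindex_rsum (fun t => complex.Im (f t)) be).
Qed.

Lemma csum_single (s : I) f : (forall t, t != s -> f t = 0) -> csum f = f s.
Proof.
move=> f0; rewrite /csum (@rsum_single _ _ s); last by move=> t ts; rewrite f0.
rewrite (@rsum_single _ _ s) /=; last by move=> t ts; rewrite f0.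
by case: (f s).
Qed.

End ComplexSums.

(** * The inner product and the norm of square-summable functions *)

Section InnerProduct.
Variables (R : realType) (I : choiceType).
Implicit Types x y z : ell2 R I.

Lemma ell2P x y : (forall t, x t = y t) -> x = y.
Proof. by move=> xy; apply: val_inj; apply/funext. Qed.

Lemma ell2DE x y t : (x + y) t = x t + y t.
Proof. by []. Qed.

Lemma ell2ZE (c : R[i]) x t : (c *: x) t = c * x t.
Proof. by []. Qed.

Lemma ell20E t : (0 : ell2 R I) t = 0.
Proof. by []. Qed.

Lemma ell2BE x y t : (x - y) t = x t - y t.
Proof. by []. Qed.

Lemma ell2_rsummable x : rsummable (fun t => Normc.normc (x t) ^+ 2).
Proof.
have /square_summableP := ell2_funP x.
rewrite /rsummable /summable => sx.
apply: le_lt_trans sx; apply: le_esum => t _ /=.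
by rewrite ger0_norm ?sqr_ge0.
Qed.

Lemma rsummable_ell2 (f : I -> R[i]^o) :
  rsummable (fun t => Normc.normc (f t) ^+ 2) -> f \in @square_summable R I.
Proof.
move=> sf; apply/square_summableP; apply: le_lt_trans sf; apply: le_esum => t _ /=.
by rewrite ger0_norm ?sqr_ge0.
Qed.

(** Since [(a - b) ^+ 2] is nonnegative, a product of two moduli is bounded by the sum of their
    squares. *)
Lemma dot_csummable x y : csummable (fun t => (x t : R[i]) * conjc (y t)).
Proof.
apply: (@rsummable_le _ _ _
  (fun t => Normc.normc (x t) ^+ 2 + Normc.normc (y t) ^+ 2)); last first.
  by apply: rsummableD; exact: ell2_rsummable.
move=> t; rewrite ger0_norm ?normc_ge0// Normc.normcM normcJ.
have := sqr_ge0 (Normc.normc (x t) - Normc.normc (y t)).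
have := normc_ge0 (x t); have := normc_ge0 (y t).
by set a := Normc.normc (x t); set b := Normc.normc (y t); nra.
Qed.

Lemma dotDl x y z : dot (x + y) z = dot x z + dot y z.
Proof.
rewrite /dot -csumD; [|exact: dot_csummable|exact: dot_csummable].
by apply: eq_csum => t; rewrite ell2DE mulrDl.
Qed.

Lemma dotZl (c : R[i]) x z : dot (c *: x) z = c * dot x z.
Proof.
rewrite /dot -csumZ; last exact: dot_csummable.
by apply: eq_csum => t; rewrite ell2ZE mulrA.
Qed.

Lemma dotC x y : dot y x = conjc (dot x y).
Proof.
by rewrite /dot -csumJ; apply: eq_csum => t; rewrite rmorphM /= conjcK mulrC.
Qed.

Lemma dotNl x z : dot (- x) z = - dot x z.
Proof. by rewrite -scaleN1r dotZl mulN1r. Qed.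

Lemma dotBl x y z : dot (x - y) z = dot x z - dot y z.
Proof. by rewrite dotDl dotNl. Qed.

Lemma dot0l z : dot 0 z = 0.
Proof. by rewrite -[0 in LHS](scale0r z) dotZl mul0r. Qed.

Lemma dotDr x y z : dot x (y + z) = dot x y + dot x z.
Proof. by rewrite dotC dotDl conjcD -!dotC. Qed.

Lemma dotBr x y z : dot x (y - z) = dot x y - dot x z.
Proof. by rewrite dotC dotBl conjcB -!dotC. Qed.

Lemma dotZr (c : R[i]) x z : dot x (c *: z) = conjc c * dot x z.
Proof. by rewrite dotC dotZl conjcM -!dotC. Qed.

Lemma norm2_ge0 x : 0 <= norm2 x.
Proof. exact: sqrtr_ge0. Qed.

Lemma sqr_norm2 x : norm2 x ^+ 2 = rsum (fun t => Normc.normc (x t) ^+ 2).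
Proof.
rewrite /norm2 sqr_sqrtr; last first.
  by rewrite fine_ge0// esum_ge0// => t _; rewrite lee_fin sqr_ge0.
by rewrite ge0_rsum//; [move=> t; exact: sqr_ge0|exact: ell2_rsummable].
Qed.

Lemma dotxx x : dot x x = (norm2 x ^+ 2)%:C%C.
Proof.
rewrite sqr_norm2 /dot (@eq_csum _ _ _ (fun t => (Normc.normc (x t) ^+ 2)%:C%C)).
  rewrite /csum/=; congr Complex; rewrite /rsum.
  by rewrite !esum1 ?subrr// => t _; rewrite ?funeposE ?funenegE/= ?oppr0 ?maxxx.
by move=> t; exact: mulcJ.
Qed.

Lemma normc_le_norm2 x t : Normc.normc (x t) <= norm2 x.
Proof.
rewrite -ler_sqr ?nnegrE ?norm2_ge0 ?normc_ge0//.
rewrite /norm2 sqr_sqrtr; last first.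
  by rewrite fine_ge0// esum_ge0// => s _; rewrite lee_fin sqr_ge0.
rewrite -lee_fin fineK; last first.
  by apply: ge0_esum_fin_num => [s|]; [exact: sqr_ge0|exact: ell2_rsummable].
rewrite (esumID [set t])//; last by move=> s _; rewrite lee_fin sqr_ge0.
rewrite !setTI esum_set1 ?lee_fin ?sqr_ge0// leeDl// esum_ge0// => s _.
by rewrite lee_fin sqr_ge0.
Qed.

Lemma norm2_eq0 x : norm2 x = 0 -> x = 0.
Proof.
move=> x0; apply: ell2P => t; apply: Normc.eq0_normc; apply/eqP.
by rewrite eq_le normc_ge0 andbT -[leRHS]x0 normc_le_norm2.
Qed.

Lemma norm2_eq_dot x y : dot x x = dot y y -> norm2 x = norm2 y.
Proof.
rewrite !dotxx => /complexI /eqP.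
by rewrite eqrXn2 ?norm2_ge0// => /eqP.
Qed.

Lemma cauchy_schwarz x y : Normc.normc (dot x y) <= norm2 x * norm2 y.
Proof.
have [y0|y0] := eqVneq (norm2 y) 0.
  rewrite (norm2_eq0 y0) dotC dot0l conjc0 Normc.normc0.
  by rewrite mulr_ge0 ?norm2_ge0.
have yp : 0 < norm2 y by rewrite lt_def y0 norm2_ge0.
(* Up to the factor [dot y y], this is the component of [x] orthogonal to [y]; scaling by that
   factor avoids a division. *)
set z := dot y y *: x - dot x y *: y.
have : dot z z = dot y y * (dot y y * dot x x - dot x y * conjc (dot x y)).
  by rewrite /z !dotBl !dotBr !dotZl !dotZr -!dotC; ring.
rewrite mulcJ !dotxx -rmorphM -rmorphB -rmorphM => /complexI zE.
have : 0 <= norm2 y ^+ 2 *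
  (norm2 y ^+ 2 * norm2 x ^+ 2 - Normc.normc (dot x y) ^+ 2).
  by rewrite -zE sqr_ge0.
rewrite pmulr_rge0 ?exprn_gt0// subr_ge0 -exprMn mulrC ler_sqr//.
  by rewrite nnegrE normc_ge0.
by rewrite nnegrE mulr_ge0 ?norm2_ge0.
Qed.

Lemma norm2Z (c : R[i]) x : norm2 (c *: x) = Normc.normc c * norm2 x.
Proof.
apply/eqP; rewrite -(@eqrXn2 _ 2) ?mulr_ge0 ?norm2_ge0 ?normc_ge0//.
apply/eqP/complexI; rewrite -dotxx dotZl dotZr mulrA mulcJ dotxx -rmorphM.
by rewrite exprMn.
Qed.

Lemma norm2D x y : norm2 (x + y) <= norm2 x + norm2 y.
Proof.
have normcR (r : R) : 0 <= r -> Normc.normc r%:C%C = r.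
  by move=> r0; rewrite /= expr0n addr0 sqrtr_sqr ger0_norm.
rewrite -ler_sqr ?nnegrE ?addr_ge0 ?norm2_ge0// -[leLHS]normcR ?sqr_ge0// -dotxx.
rewrite dotDl !dotDr; apply: (le_trans (le_normcD _ _)).
apply: (le_trans (lerD (le_normcD _ _) (le_normcD _ _))).
rewrite !dotxx !normcR ?sqr_ge0//.
have := cauchy_schwarz x y; have := cauchy_schwarz y x; nra.
Qed.

End InnerProduct.

(** * Basis vectors and density of the finitely supported functions *)

Section FiniteSupport.
Variables (R : realType) (G : groupType).
Implicit Types (x y z : ell2 R G) (F : seq G).

Lemma dot_delta x t : dot x (delta R t) = x t.
Proof.
rewrite /dot (@csum_single _ _ t)/=; first by rewrite eqxx conjc1 mulr1.
by move=> s st; rewrite (negbTE st) conjc0 mulr0.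
Qed.

Lemma delta_dot x t : dot (delta R t) x = conjc (x t).
Proof. by rewrite dotC dot_delta. Qed.

Lemma deltaE (s t : G) : delta R t s = (s == t)%:R.
Proof. by []. Qed.

Lemma dot_injr y z : (forall x, dot x y = dot x z) -> y = z.
Proof.
move=> yz; apply: ell2P => t; apply: (can_inj (@conjcK R)).
by rewrite -!delta_dot.
Qed.

Lemma dot_suml (J : Type) (r : seq J) (f : J -> ell2 R G) y :
  dot (\sum_(j <- r) f j) y = \sum_(j <- r) dot (f j) y.
Proof.
by elim/big_rec2: _ => [|j s x _ <-]; rewrite ?dot0l// dotDl.
Qed.

Definition finite_comb F (c : G -> R[i]) : ell2 R G :=
  \sum_(r <- F) c r *: delta R r.

Lemma dot_finite_combl F c y :
  dot (finite_comb F c) y = \sum_(r <- F) c r * conjc (y r).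
Proof.
by rewrite dot_suml; apply: eq_bigr => r _; rewrite dotZl delta_dot.
Qed.

Lemma finite_combE F c t : uniq F ->
  finite_comb F c t = if t \in F then c t else 0.
Proof.
move=> uF; rewrite -dot_delta dot_finite_combl; case: ifPn => tF.
  rewrite (bigD1_seq t)// deltaE eqxx conjc1 mulr1 big1; first exact: addr0.
  move=> r rt.
  by rewrite deltaE (negbTE rt) conjc0 mulr0.
rewrite big_seq big1// => r rF; rewrite deltaE.
by case: eqP rF tF => [-> ->//|_ _ _]; rewrite conjc0 mulr0.
Qed.

Lemma norm2_finite_comb F c : uniq F ->
  norm2 (finite_comb F c) ^+ 2 = \sum_(r <- F) Normc.normc (c r) ^+ 2.
Proof.
move=> uF; apply: (@complexI R); rewrite -dotxx dot_finite_combl rmorph_sum.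
rewrite big_seq [RHS]big_seq; apply: eq_bigr => r rF.
by rewrite finite_combE// rF mulcJ.
Qed.

(** Pythagoras: the truncation of [x] is orthogonal to the remainder. *)
Lemma norm2_sub_trunc F x : uniq F ->
  norm2 (x - finite_comb F x) ^+ 2 =
  norm2 x ^+ 2 - \sum_(r <- F) Normc.normc (x r) ^+ 2.
Proof.
move=> uF; have sE : dot (finite_comb F x) x =
    (\sum_(r <- F) Normc.normc (x r) ^+ 2)%:C%C.
  by rewrite dot_finite_combl rmorph_sum; apply: eq_bigr => r _; rewrite mulcJ.
apply: (@complexI R); rewrite -dotxx dotBl !dotBr (dotC (finite_comb F x) x) sE conjc_real.
by rewrite !dotxx norm2_finite_comb// subrr subr0 rmorphB.
Qed.

Lemma trunc_approx x (e : R) : 0 < e ->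
  exists2 F, uniq F & norm2 (x - finite_comb F x) < e.
Proof.
move=> e0; have e20 : 0 < e ^+ 2 by rewrite exprn_gt0.
have nn t : 0 <= Normc.normc (x t) ^+ 2 by exact: sqr_ge0.
(* The squared norm is a supremum of finite sums, so some finite set captures it up to [e ^+ 2]. *)
have [y [A [finA _] <-]] := ub_ereal_sup_adherent e20
  (ge0_esum_fin_num nn (ell2_rsummable x)).
rewrite -/(esum _ _) fsbig_finite// sumEFin => H.
exists (finmap.enum_fset (fset_set A)); first exact: finmap.fset_uniq.
rewrite -ltr_sqr ?nnegrE ?norm2_ge0 ?ltW//.
rewrite norm2_sub_trunc; last exact: finmap.fset_uniq.
rewrite ltrBlDr -ltrBlDl -lte_fin; apply: le_lt_trans H.
rewrite sqr_norm2 ge0_rsum//; last exact: ell2_rsummable.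
by rewrite EFinB fineK// ge0_esum_fin_num//; exact: ell2_rsummable.
Qed.

(** Linearity makes [f] vanish on all truncations, so a nonzero [f x] would contradict the bound at
    [x] minus a close enough truncation. *)
Lemma bounded_functional_eq0 (f : ell2 R G -> R[i]) (K : R) :
  (forall x y, f (x + y) = f x + f y) ->
  (forall c x, f (c *: x) = c * f x) ->
  (forall x, Normc.normc (f x) <= K * norm2 x) ->
  (forall t, f (delta R t) = 0) -> forall x, f x = 0.
Proof.
move=> fD fZ fK fd x; apply: Normc.eq0_normc; apply/eqP; apply: contraT => fx0.
have a0 : 0 < Normc.normc (f x) by rewrite lt_def fx0 normc_ge0.
have f0 : f 0 = 0 by rewrite -(scale0r (0 : ell2 R G)) fZ mul0r.
have fF F c : f (finite_comb F c) = 0.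
  rewrite /finite_comb; elim/big_rec: _ => // r y _ y0.
  by rewrite fD y0 fZ fd mulr0 addr0.
(* Adding 1 keeps the divisor positive even if [K] is 0. *)
have K1 : 0 < `|K| + 1 by rewrite ltr_wpDl.
have [F _ HF] := trunc_approx x (divr_gt0 a0 K1).
have := fK (x - finite_comb F x); rewrite fD -scaleN1r fZ fF mulr0 addr0 leNgt.
case/negP; apply: (@le_lt_trans _ _ ((`|K| + 1) * norm2 (x - finite_comb F x))).
  rewrite scaleN1r; apply: ler_wpM2r; first exact: norm2_ge0.
  by rewrite (le_trans (ler_norm _))// lerDl.
by rewrite mulrC -ltr_pdivlMr.
Qed.

End FiniteSupport.

(** * Bounded operators, adjoints and unitaries *)

Section BoundedOperators.
Variables (R : realType) (G : groupType).
Implicit Types (x y z : ell2 R G) (u v : ell2 R G -> ell2 R G).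

Lemma bounded_opD u : bounded_op u -> forall x y, u (x + y) = u x + u y.
Proof. by move=> [/(_ 1) ul _] x y; have := ul x y; rewrite !scale1r. Qed.

Lemma bounded_op0 u : bounded_op u -> u 0 = 0.
Proof. by move=> bu; apply: (addIr (u 0)); rewrite -(bounded_opD bu) !add0r. Qed.

Lemma bounded_opZ u : bounded_op u -> forall (c : R[i]) x, u (c *: x) = c *: u x.
Proof.
by move=> bu c x; have [ul _] := bu; have := ul c x 0; rewrite (bounded_op0 bu) !addr0.
Qed.

Lemma bounded_op_ge0 u : bounded_op u ->
  exists2 C, 0 <= C & forall x, norm2 (u x) <= C * norm2 x.
Proof.
move=> [_ [C uC]]; exists `|C| => // x; apply: (le_trans (uC x)).
by rewrite ler_wpM2r ?norm2_ge0// ler_norm.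
Qed.

Lemma bounded_op_add u v : bounded_op u -> bounded_op v ->
  bounded_op (fun x => u x + v x).
Proof.
move=> bu bv; split=> [c x y|].
  rewrite (bounded_opD bu) (bounded_opD bv) (bounded_opZ bu) (bounded_opZ bv).
  by rewrite scalerDr addrACA.
have [[_ [C uC]] [_ [D vD]]] := (bu, bv); exists (C + D) => x.
by rewrite mulrDl (le_trans (norm2D _ _))// lerD.
Qed.

Lemma bounded_op_cst0 : bounded_op (fun _ : ell2 R G => 0 : ell2 R G).
Proof.
split=> [c x y|]; first by rewrite scaler0 addr0.
by exists 0 => x; rewrite mul0r -[X in norm2 X](scale0r x) norm2Z Normc.normc0 mul0r.
Qed.

Lemma bounded_op_comp u v : bounded_op u -> bounded_op v -> bounded_op (u \o v).
Proof.
move=> bu bv; split=> [c x y|] /=.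
  by rewrite (bounded_opD bv) (bounded_opZ bv) (bounded_opD bu) (bounded_opZ bu).
have [C C0 uC] := bounded_op_ge0 bu; have [_ [D vD]] := bv.
by exists (C * D) => x; rewrite (le_trans (uC _))// -mulrA ler_wpM2l.
Qed.

Lemma adjoint_exists u : bounded_op u ->
  forall y, exists z, forall x, dot (u x) y = dot x z.
Proof.
move=> bu y; have [C C0 uC] := bounded_op_ge0 bu.
pose z (r : G) : R[i]^o := conjc (dot (u (delta R r)) y).
have u_comb F c : dot (u (finite_comb F c)) y = \sum_(r <- F) c r * conjc (z r).
  rewrite /finite_comb; elim/big_rec2: _ => [|r a x _ <-].
    by rewrite (bounded_op0 bu) dot0l.
  by rewrite (bounded_opD bu) (bounded_opZ bu) dotDl dotZl conjcK.
have zs : z \in @square_summable R G.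
  apply/square_summableP.
  apply: (@le_lt_trans _ _ ((C * norm2 y) ^+ 2)%:E); last exact: ltry.
  apply: ge_ereal_sup => _ [A [finA _] <-].
  rewrite fsbig_finite// sumEFin lee_fin.
  set F := finmap.enum_fset _; have uF : uniq F by exact: finmap.fset_uniq.
  have nE := norm2_finite_comb z uF.
  (* Tested on the truncation of [z] itself, Cauchy-Schwarz bounds its squared norm [n ^+ 2] by
     [n * (C * m)], and one factor [n] cancels. *)
  have := cauchy_schwarz (u (finite_comb F z)) y; rewrite u_comb.
  under eq_bigr do rewrite mulcJ.
  rewrite -rmorph_sum -nE /= expr0n addr0 sqrtr_sqr ger0_norm ?sqr_ge0//.
  move=> H; have := uC (finite_comb F z); have := norm2_ge0 (finite_comb F z).
  move: H (norm2_ge0 y); set n := norm2 _; set m := norm2 y.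
  set w := norm2 (u _) => H m0 n0 wn.
  have [->|n1] := eqVneq n 0; first by rewrite expr0n sqr_ge0.
  have np : 0 < n by rewrite lt_def n1.
  rewrite ler_sqr ?nnegrE ?mulr_ge0//.
  have : n * n <= n * (C * m).
    rewrite -expr2 (le_trans H)// mulrA [n * C]mulrC.
    exact: ler_wpM2r.
  by rewrite ler_pM2l.
exists (Ell2 zs) => x; apply/eqP; rewrite -subr_eq0; apply/eqP.
(* The two sides are bounded linear functionals of [x] that agree on basis vectors. *)
apply: (@bounded_functional_eq0 _ _ (fun x => dot (u x) y - dot x (Ell2 zs))
  (C * norm2 y + norm2 (Ell2 zs))).
- by move=> a b; rewrite (bounded_opD bu) !dotDl opprD addrACA.
- by move=> c a; rewrite (bounded_opZ bu) !dotZl mulrBr.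
- move=> a; rewrite mulrDl (le_trans (le_normcD _ _))// normcN lerD//.
    rewrite (le_trans (cauchy_schwarz _ _))// mulrAC.
    by rewrite ler_wpM2r ?norm2_ge0.
  by rewrite mulrC cauchy_schwarz.
- by move=> t; rewrite delta_dot -[Ell2 zs t]/(z t) conjcK subrr.
Qed.

Lemma adjP u x y : bounded_op u -> dot (u x) y = dot x (adj u y).
Proof. by move=> bu; exact: (xgetPex 0 (adjoint_exists bu y)). Qed.

Lemma adjPr u x y : bounded_op u -> dot x (u y) = dot (adj u x) y.
Proof. by move=> bu; rewrite dotC adjP// -dotC. Qed.

Lemma adj_unique u v : bounded_op u ->
  (forall x y, dot (u x) y = dot x (v y)) -> adj u = v.
Proof.
move=> bu uv; apply/funext => y; apply: dot_injr => x.
by rewrite -adjP.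
Qed.

Lemma bounded_adj u : bounded_op u -> bounded_op (adj u).
Proof.
move=> bu; split=> [c x y|].
  by apply: dot_injr => a; rewrite -adjP// !(dotDr, dotZr) -!adjP.
have [C C0 uC] := bounded_op_ge0 bu; exists C => y.
set n := norm2 (adj u y); have n0 : 0 <= n by exact: norm2_ge0.
have [->|n1] := eqVneq n 0; first by rewrite mulr_ge0 ?norm2_ge0.
have np : 0 < n by rewrite lt_def n1.
have : n * n <= n * (C * norm2 y); last by rewrite ler_pM2l.
(* The left side is the squared norm of [adj u y], so again one factor [n] cancels. *)
have := cauchy_schwarz (u (adj u y)) y.
rewrite adjP// dotxx /= expr0n addr0 sqrtr_sqr ger0_norm ?sqr_ge0// -/n expr2.
move=> /le_trans; apply; rewrite mulrA [n * C]mulrC.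
by rewrite ler_wpM2r ?norm2_ge0.
Qed.

Lemma adjK u : bounded_op u -> adj (adj u) = u.
Proof.
move=> bu; apply: adj_unique; first exact: bounded_adj.
by move=> x y; rewrite -adjPr.
Qed.

Lemma adj_comp u v : bounded_op u -> bounded_op v ->
  adj (u \o v) = adj v \o adj u.
Proof.
move=> bu bv; apply: adj_unique; first exact: bounded_op_comp.
by move=> x y /=; rewrite !adjP.
Qed.

(** The adjoint rewrites [u x t] as the inner product of [x] with [adj u (delta R t)]; no limit has
    to be moved through [u]. *)
Lemma bounded_op_matrix u x t : bounded_op u ->
  u x t = csum (fun r => x r * u (delta R r) t).
Proof.
move=> bu; rewrite -dot_delta adjP// /dot; apply: eq_csum => r.
by rewrite -[adj u _ r]dot_delta -adjPr// delta_dot conjcK.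
Qed.

Lemma bounded_op_eq u v : bounded_op u -> bounded_op v ->
  (forall r, u (delta R r) = v (delta R r)) -> u = v.
Proof.
move=> bu bv uv; apply/funext => x; apply: ell2P => t.
by rewrite !bounded_op_matrix//; apply: eq_csum => r; rewrite uv.
Qed.

Lemma unitary_dot u x y : bounded_op u -> unitary u -> dot (u x) (u y) = dot x y.
Proof. by move=> bu [uu _]; rewrite adjP// -[adj u (u y)]/((adj u \o u) y) uu. Qed.

Lemma norm2_unitary u x : bounded_op u -> unitary u -> norm2 (u x) = norm2 x.
Proof. by move=> bu uu; apply: norm2_eq_dot; exact: unitary_dot. Qed.

Lemma unitary_adj u : bounded_op u -> unitary u -> unitary (adj u).
Proof. by move=> bu [u1 u2]; split; rewrite adjK. Qed.

Lemma unitary_comp u v : bounded_op u -> bounded_op v ->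
  unitary u -> unitary v -> unitary (u \o v).
Proof.
move=> bu bv [u1 u2] [v1 v2]; rewrite /unitary adj_comp//.
split; apply/funext => x /=.
  by rewrite -[adj u _]/((adj u \o u) (v x)) u1 -[RHS]/(id x) -v1.
by rewrite -[v (adj v _)]/((v \o adj v) _) v2 -[RHS]/(id x) -u2.
Qed.

End BoundedOperators.

(** * Commutants and generated von Neumann algebras *)

Section Commutants.
Variables (R : realType) (G : groupType).
Implicit Types (S T M : set (ell2 R G -> ell2 R G)) (u v : ell2 R G -> ell2 R G).

Lemma commutantS S T : S `<=` T -> commutant T `<=` commutant S.
Proof. by move=> ST u [bu uT]; split=> // v /ST; exact: uT. Qed.

Lemma bicommutant_sub S : S `<=` @bounded_op R G -> S `<=` commutant (commutant S).
Proof.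
by move=> bS u Su; split; [exact: bS|move=> v [_ vS]; rewrite vS].
Qed.

Lemma commutant_bounded S : commutant S `<=` @bounded_op R G.
Proof. by move=> u []. Qed.

Lemma tricommutant S : S `<=` @bounded_op R G ->
  commutant (commutant (commutant S)) = commutant S.
Proof.
move=> bS; apply/seteqP; split; first exact/commutantS/bicommutant_sub.
exact/bicommutant_sub/commutant_bounded.
Qed.

(** Take adjoints in the relation saying that [v] commutes with [adj u]. *)
Lemma commutant_adj S : S `<=` @bounded_op R G ->
  (forall u, S u -> S (adj u)) -> forall v, commutant S v -> commutant S (adj v).
Proof.
move=> bS aS v [bv vS]; split; first exact: bounded_adj.
move=> u Su; have bu := bS u Su; have bau := bounded_adj bu.
have := congr1 (@adj R G) (vS _ (aS u Su)).
by rewrite (adj_comp bv bau) (adj_comp bau bv) (adjK bu) => <-.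
Qed.

Lemma commutant_comp S u v : commutant S u -> commutant S v -> commutant S (u \o v).
Proof.
move=> [bu uS] [bv vS]; split; first exact: bounded_op_comp.
move=> w Sw; apply/funext => x /=.
have := congr1 (@^~ (v x)) (uS w Sw); have := congr1 (@^~ x) (vS w Sw).
by move=> /= <- ->.
Qed.

(** Serves to place the sum of the [lambda R c] over a finite conjugacy class in L(G). *)
Lemma commutant_sum (J : Type) S (r : seq J) (f : J -> ell2 R G -> ell2 R G) :
  S `<=` @bounded_op R G -> (forall c, commutant S (f c)) ->
  commutant S (fun x => \sum_(c <- r) f c x).
Proof.
move=> bS fS; elim: r => [|a r IH].
  under eq_fun do rewrite big_nil.
  split; first exact: bounded_op_cst0.
  by move=> v /bS bv; apply/funext => x /=; rewrite (bounded_op0 bv).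
under eq_fun do rewrite big_cons.
have [ba aS] := fS a; have [br rS] := IH.
split; first exact: bounded_op_add.
move=> v Sv; apply/funext => x /=; rewrite (bounded_opD (bS _ Sv)).
by have := congr1 (@^~ x) (aS v Sv); have := congr1 (@^~ x) (rS v Sv) => /= -> ->.
Qed.

Lemma bicommutant_vN S : S `<=` @bounded_op R G ->
  (forall u, S u -> S (adj u)) -> von_neumann_algebra (commutant (commutant S)).
Proof.
move=> bS aS; split; first exact: commutant_bounded.
  by apply: commutant_adj; [exact: commutant_bounded|exact: commutant_adj].
by rewrite tricommutant//; exact: commutant_bounded.
Qed.

(** The double commutant is monotone and fixes every von Neumann algebra, so each one that contains
    [S] contains the bicommutant of [S], which is one itself. *)
Lemma vN_generatedE S : S `<=` @bounded_op R G ->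
  (forall u, S u -> S (adj u)) -> vN_generated S = commutant (commutant S).
Proof.
move=> bS aS; apply/seteqP; split=> u.
  by apply; split; [exact: bicommutant_vN|exact: bicommutant_sub].
by move=> uS M [[_ _ ME] SM]; rewrite ME; apply: commutantS uS; exact: commutantS.
Qed.

End Commutants.

(** * Left and right translations, restrictions, and L(H) as a bicommutant *)

Section RegularRepresentationTheory.
Variables (R : realType) (G : groupType).
Implicit Types (x y : ell2 R G) (s t g h : G) (K : set G).
Implicit Types (u v w : ell2 R G -> ell2 R G).

Lemma norm2_reindex (e : G -> G) x y : bijective e ->
  (forall t, y t = x (e t)) -> norm2 y = norm2 x.
Proof.
move=> be yx; apply: norm2_eq_dot.
rewrite /dot -[RHS](reindex_csum _ be); apply: eq_csum => t /=.
by rewrite yx.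
Qed.

Lemma norm2_lambda s x : norm2 (lambda R s x) = norm2 x.
Proof.
apply: (@norm2_reindex (fun t => s^-1 * t)%g) => //.
by exists (fun t => s * t)%g => t; rewrite ?mulKg ?mulVKg.
Qed.

Lemma bounded_lambda s : bounded_op (lambda R s).
Proof.
split=> [c x y|]; first exact: ell2P.
by exists 1 => x; rewrite mul1r norm2_lambda.
Qed.

Lemma lambdaM s t x : lambda R s (lambda R t x) = lambda R (s * t)%g x.
Proof. by apply: ell2P => r /=; rewrite invgM mulgA. Qed.

Lemma lambda1 : lambda R (1 : G)%g = id.
Proof. by apply/funext => x; apply: ell2P => r /=; rewrite invg1 mul1g. Qed.

Lemma lambdaK s x : lambda R s^-1%g (lambda R s x) = x.
Proof. by rewrite lambdaM mulVg lambda1. Qed.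

Lemma lambdaVK s x : lambda R s (lambda R s^-1%g x) = x.
Proof. by rewrite lambdaM mulgV lambda1. Qed.

Lemma adj_lambda s : adj (lambda R s) = lambda R s^-1%g.
Proof.
apply: adj_unique; first exact: bounded_lambda.
move=> x y; rewrite /dot.
have be : bijective (fun t : G => s^-1 * t)%g.
  by exists (fun t => s * t)%g => t; rewrite ?mulKg ?mulVKg.
rewrite -[RHS](reindex_csum _ be); apply: eq_csum => t /=.
by rewrite invgK mulVKg.
Qed.

Lemma unitary_lambda s : unitary (lambda R s).
Proof.
rewrite /unitary adj_lambda; split; apply/funext => x /=.
  exact: lambdaK.
exact: lambdaVK.
Qed.

Lemma rtranslate_square_summable s x :
  (fun t => x (t * s)%g) \in @square_summable R G.
Proof.
apply/square_summableP; have /square_summableP := ell2_funP x.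
rewrite (reindex_esum [set: G] [set: G] (fun t => t * s)%g)//.
split=> // [t t' _ _ /mulIg //|t _]; exists (t * s^-1)%g => //.
by rewrite mulgVK.
Qed.

(** The right regular representation, which commutes with every [lambda R g] and hence with L(G). *)
Definition rho s x : ell2 R G := Ell2 (rtranslate_square_summable s x).

Lemma norm2_rho s x : norm2 (rho s x) = norm2 x.
Proof.
apply: (@norm2_reindex (fun t => t * s)%g) => //.
by exists (fun t => t * s^-1)%g => t; rewrite ?mulgK ?mulgVK.
Qed.

Lemma bounded_rho s : bounded_op (rho s).
Proof.
split=> [c x y|]; first exact: ell2P.
by exists 1 => x; rewrite mul1r norm2_rho.
Qed.

Lemma rho_delta s t : rho s (delta R t) = delta R (t * s^-1)%g.
Proof.
apply: ell2P => r /=; congr (nat_of_bool _)%:R.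
by apply/eqP/eqP => [<-|->]; rewrite ?mulgK ?mulgVK.
Qed.

Lemma rho_lambda s g x : rho s (lambda R g x) = lambda R g (rho s x).
Proof. by apply: ell2P => t /=; rewrite mulgA. Qed.

Lemma restrict_square_summable K x :
  (fun t => if t \in K then x t else 0) \in @square_summable R G.
Proof.
apply: rsummable_ell2; apply: rsummable_le (ell2_rsummable x) => t.
rewrite ger0_norm ?sqr_ge0//; case: ifP => // _.
by rewrite Normc.normc0 expr0n sqr_ge0.
Qed.

(** The orthogonal projection onto the functions supported on [K]. *)
Definition restrict K x : ell2 R G := Ell2 (restrict_square_summable K x).

Lemma restrictE K x t : restrict K x t = if t \in K then x t else 0.
Proof. by []. Qed.

(** The products of [restrict K x] with [x] and with itself coincide; Cauchy-Schwarz then allows one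
    factor to be cancelled. *)
Lemma norm2_restrict K x : norm2 (restrict K x) <= norm2 x.
Proof.
set n := norm2 (restrict K x); have n0 : 0 <= n by exact: norm2_ge0.
have [->|n1] := eqVneq n 0; first exact: norm2_ge0.
have np : 0 < n by rewrite lt_def n1.
rewrite -(ler_pM2l np) -expr2 -[leLHS]ger0_norm ?sqr_ge0//.
have := cauchy_schwarz (restrict K x) x.
have -> : dot (restrict K x) x = dot (restrict K x) (restrict K x).
  by apply: eq_csum => t; rewrite !restrictE; case: ifP; rewrite ?mul0r.
by rewrite dotxx /= expr0n addr0 sqrtr_sqr.
Qed.

Lemma bounded_restrict K : bounded_op (restrict K).
Proof.
split=> [c x y|].
  apply: ell2P => t; rewrite ell2DE ell2ZE !restrictE.
  by case: ifP => _; rewrite ?mulr0 ?addr0.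
by exists 1 => x; rewrite mul1r norm2_restrict.
Qed.

Lemma restrict_rho K s x :
  restrict K (rho s x) = rho s (restrict [set t | K (t * s^-1)%g] x).
Proof.
apply: ell2P => t; rewrite /=; congr (if _ then _ else _).
by apply/idP/idP; rewrite !inE /= mulgK.
Qed.

Lemma restrict_lambda K h x : (forall t, K (h * t)%g <-> K t) ->
  restrict K (lambda R h x) = lambda R h (restrict K x).
Proof.
move=> hK; apply: ell2P => t; rewrite /= ; congr (if _ then _ else _).
have := hK (h^-1 * t)%g; rewrite mulVKg => hKt.
by apply/idP/idP; rewrite !inE hKt.
Qed.

Lemma subgroupP (H : set G) : group_closed [in H] ->
  [/\ H 1%g, (forall s t, H s -> H t -> H (s * t)%g) & (forall s, H s -> H s^-1%g)].
Proof.
move=> Hg; have V s : H s -> H s^-1%g.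
  by move=> Hs; have := group_closedV Hg (mem_set Hs); rewrite inE.
have [H1 HD] := Hg; split=> //; first by move: H1; rewrite inE.
move=> s t Hs Ht; have := HD s t^-1%g (mem_set Hs) (mem_set (V _ Ht)).
by rewrite invgK inE.
Qed.

Lemma group_vNE (H : set G) : group_closed [in H] ->
  group_vN R H = commutant (commutant [set lambda R h | h in H]).
Proof.
move=> /subgroupP[_ _ HV]; apply: vN_generatedE.
  by move=> _ [h _ <-]; exact: bounded_lambda.
by move=> _ [h Hh <-]; rewrite adj_lambda; exists h^-1%g => //; exact: HV.
Qed.

Lemma lambda_in_vN (H : set G) h : group_closed [in H] -> H h ->
  group_vN R H (lambda R h).
Proof.
move=> Hg Hh; rewrite group_vNE//; apply: bicommutant_sub; last by exists h.
by move=> _ [k _ <-]; exact: bounded_lambda.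
Qed.

Lemma group_closedT : group_closed [in [set: G]].
Proof. by split=> [|x y _ _]; rewrite inE. Qed.

Lemma group_vN_adj (H : set G) u : group_closed [in H] ->
  group_vN R H u -> group_vN R H (adj u).
Proof.
move=> Hg uH M MH; have [[_ MA _] _] := MH.
by apply: MA; exact: uH.
Qed.

Lemma group_vN_comp (H : set G) u v : group_closed [in H] ->
  group_vN R H u -> group_vN R H v -> group_vN R H (u \o v).
Proof. by move=> Hg; rewrite group_vNE//; exact: commutant_comp. Qed.

Lemma group_vN_bounded (H : set G) u : group_closed [in H] ->
  group_vN R H u -> bounded_op u.
Proof. by move=> Hg; rewrite group_vNE//; exact: commutant_bounded. Qed.

Lemma group_vN_rho u s x : group_vN R [set: G] u -> u (rho s x) = rho s (u x).
Proof.
rewrite group_vNE; last exact: group_closedT.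
move=> [_ /(_ (rho s))] uC; have := congr1 (@^~ x) (uC _); rewrite /=.
move=> /(_ _)-> //; split; first exact: bounded_rho.
by move=> _ [g _ <-]; apply/funext => y /=; rewrite rho_lambda.
Qed.

(** As [K] is a union of right cosets of [H], its projection commutes with all [lambda R h] for [h]
    in [H], hence with their bicommutant. *)
Lemma group_vN_restrict (H : set G) K u x : group_closed [in H] ->
  (forall h t, H h -> K t -> K (h * t)%g) ->
  group_vN R H u -> u (restrict K x) = restrict K (u x).
Proof.
move=> Hg HK; rewrite group_vNE// => -[_ /(_ (restrict K))] uC.
have := congr1 (@^~ x) (uC _); rewrite /= => /(_ _)-> //.
split; first exact: bounded_restrict.
move=> _ [h Hh <-]; apply/funext => y /=; rewrite restrict_lambda// => t.
split; last exact: HK.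
have [_ _ HV] := subgroupP Hg.
by move=> /(HK _ _ (HV _ Hh)); rewrite mulKg.
Qed.

(** Every basis vector is a right translate of [delta R 1], and [u] commutes with right
    translations. Thus [u] is determined by the single vector [u (delta R 1)]. *)
Lemma group_vN_delta u s t : group_vN R [set: G] u ->
  u (delta R s) t = u (delta R 1%g) (t * s^-1)%g.
Proof.
by move=> uG; rewrite -[in LHS](mul1g s) -{1}[s]invgK -rho_delta group_vN_rho.
Qed.

(* On basis vectors both products are the convolution of [w delta_1] with [v delta_s]. *)
Lemma group_vN_support (H : set G) w : group_closed [in H] ->
  group_vN R [set: G] w ->
  (forall t, w (delta R 1%g) t != 0 -> H t) -> group_vN R H w.
Proof.
move=> Hg wG wH; have bw := group_vN_bounded group_closedT wG.
rewrite group_vNE//; split=> // v [bv vC].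
have vwb := bounded_op_comp bv bw; have wvb := bounded_op_comp bw bv.
apply: (bounded_op_eq vwb wvb) => s; apply: ell2P => t /=.
rewrite (bounded_op_matrix _ _ bv) (bounded_op_matrix _ _ bw).
(* Chosen so that [t * (e r)^-1 = r * s^-1]: the coefficients of [w] in the two convolutions then
   match term by term. *)
pose e (r : G) := (s * r^-1 * t)%g.
have be : bijective e.
  exists (fun q => t * q^-1 * s)%g => q; rewrite /e !invgM !invgK.
    by rewrite !mulgA mulgV mul1g mulgVK.
  by rewrite !mulgA mulgV mul1g mulgVK.
rewrite -[RHS](reindex_csum _ be); apply: eq_csum => r.
rewrite /= (group_vN_delta s r wG) (group_vN_delta (e r) t wG).
have -> : (t * (e r)^-1)%g = (r * s^-1)%g.
  by rewrite /e !invgM invgK !mulgA mulgV mul1g.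
have [->|wr] := eqVneq (w (delta R 1%g) (r * s^-1)%g) 0.
  by rewrite mul0r mulr0.
rewrite mulrC; congr (_ * _).
(* Here [r * s^-1] lies in [H], so [v] commutes with its left translation, which sends [delta R s]
   to [delta R r]. *)
have Hh := wH _ wr; have := congr1 (@^~ (delta R s)) (vC _ (ex_intro2 _ _ _ Hh erefl)).
rewrite /= lambda_delta mulgVK => <- /=.
by rewrite invgM invgK.
Qed.

End RegularRepresentationTheory.

(** * Irreducibility, conjugacy classes under [H] and right cosets of [H] *)

Section Irreducible.
Variables (R : realType) (G : groupType) (H : set G).
Hypothesis H_subgroup : group_closed [in H].
Implicit Types (s t g h : G) (x y : ell2 R G) (u v w : ell2 R G -> ell2 R G).

(** If the class of [t] were finite, the sum [T] of [lambda R c] over it would lie in L(G) and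
    commute with L(H). It would then be scalar, yet [T (delta R 1)] takes the value 1 at [t], which
    differs from the identity. *)
Lemma irreducible_infinite_classes :
  commutant (group_vN R H) `&` group_vN R [set: G] = @scalar_ops R G ->
  forall t, t <> 1%g -> infinite_set [set h * t * h^-1 | h in H]%g.
Proof.
move=> irr t t1 finA; set A := (X in finite_set X) in finA.
have [H1 HM HV] := subgroupP H_subgroup.
pose F : seq G := finmap.enum_fset (fset_set A).
have uF : uniq F by exact: finmap.fset_uniq.
have FP s : (s \in F) = (s \in A) by rewrite /F in_fset_set.
pose T x : ell2 R G := \sum_(c <- F) lambda R c x.
have bH : [set lambda R h | h in H] `<=` @bounded_op R G.
  by move=> _ [h _ <-]; exact: bounded_lambda.
have TG : group_vN R [set: G] T.
  rewrite group_vNE; last exact: group_closedT.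
  apply: commutant_sum; first exact: commutant_bounded.
  move=> c; have := @lambda_in_vN R _ _ c (@group_closedT G) I.
  by rewrite group_vNE//; exact: group_closedT.
have TH : commutant (group_vN R H) T.
  rewrite group_vNE// tricommutant//; split.
    exact: group_vN_bounded (@group_closedT G) TG.
  move=> _ [h Hh <-]; apply/funext => x; rewrite /T /=.
  have -> : lambda R h (\sum_(c <- F) lambda R c x) =
      \sum_(c <- F) lambda R h (lambda R c x).
    elim: (F) => [|a r IH]; first by rewrite !big_nil (bounded_op0 (bounded_lambda _ _)).
    by rewrite !big_cons (bounded_opD (bounded_lambda _ _)) IH.
  (* Conjugation by [h] permutes the class, so it only reorders the sum. *)
  have pF : perm_eq [seq (h * c * h^-1)%g | c <- F] F.
    apply: uniq_perm => //; first by rewrite map_inj_uniq// => a b /mulIg/mulgI.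
    move=> s; apply/mapP/idP => [[c]|].
      rewrite !FP !inE => -[k Hk <-] ->; exists (h * k)%g; first exact: HM.
      by rewrite invgM !mulgA.
    rewrite FP inE => -[k Hk <-]; exists (h^-1 * (k * t * k^-1) * h)%g.
      rewrite FP inE; exists (h^-1 * k)%g; first by apply: HM => //; exact: HV.
      by rewrite invgM invgK !mulgA.
    by rewrite !mulgA mulgV mul1g mulgK.
  rewrite -[RHS](perm_big _ pF) big_map; apply: eq_bigr => c _.
  by rewrite !lambdaM mulgVK.
have : scalar_ops T by rewrite -irr; split.
move=> [c Tc]; have := congr1 (fun f : ell2 R G -> ell2 R G => f (delta R 1%g) t) Tc.
rewrite ell2ZE deltaE (introF eqP t1) mulr0 /T.
under eq_bigr do rewrite lambda_delta mulg1 -[delta R _](scale1r).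
rewrite -/(finite_comb F (fun _ => 1)) finite_combE// FP.
rewrite mem_set; first by move/eqP; rewrite oner_eq0.
by exists 1%g => //; rewrite mul1g invg1 mulg1.
Qed.

Definition right_coset g : set G := [set t | H (t * g^-1)%g].

Lemma right_coset_mull g h t : H h -> right_coset g t -> right_coset g (h * t)%g.
Proof.
have [_ HM _] := subgroupP H_subgroup.
by move=> Hh; rewrite /right_coset /= -mulgA; exact: HM.
Qed.

Lemma right_coset_id g : right_coset g g.
Proof.
by have [H1 _ _] := subgroupP H_subgroup; rewrite /right_coset /= mulgV.
Qed.

Lemma right_coset_meet g s t :
  right_coset g t -> right_coset s t -> H (g * s^-1)%g.
Proof.
have [_ HM HV] := subgroupP H_subgroup.
move=> /HV gt st; have := HM _ _ gt st.
by rewrite invgM invgK mulgA mulgVK.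
Qed.

Lemma right_coset_eq g s : H (g * s^-1)%g -> right_coset g = right_coset s.
Proof.
have [_ HM HV] := subgroupP H_subgroup.
move=> gs; apply/seteqP; split=> t; rewrite /right_coset /= => tH.
  by have := HM _ _ tH gs; rewrite mulgA mulgVK.
by have := HM _ _ tH (HV _ gs); rewrite invgM invgK mulgA mulgVK.
Qed.

(** A truncation of [x] with error below the modulus of [a] cannot omit a point where [x] takes the
    value [a]. *)
Lemma finite_value_set x (a : R[i]) : a != 0 ->
  exists F : seq G, forall s, x s = a -> s \in F.
Proof.
move=> a0; have na : 0 < Normc.normc a.
  rewrite lt_def normc_ge0 andbT; apply: contra a0 => /eqP.
  by move=> /Normc.eq0_normc ->.
have [F uF HF] := trunc_approx x na; exists F => s xs.
apply: contraLR HF => sF; rewrite -leNgt.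
have := normc_le_norm2 (x - finite_comb F x) s.
by rewrite ell2BE finite_combE// (negbTE sF) subr0 xs.
Qed.

(** * The one-sided normalizer of L(H) *)

Section Normalizer.
Variable u : ell2 R G -> ell2 R G.
Hypothesis uN : one_sided_normalizer (group_vN R [set: G]) (group_vN R H) u.

Let xi := u (delta R 1%g).

Let uG : group_vN R [set: G] u. Proof. by have [] := uN. Qed.
Let uu : unitary u. Proof. by have [] := uN. Qed.
Let bu : bounded_op u. Proof. exact: group_vN_bounded (@group_closedT G) uG. Qed.
Let uaG : group_vN R [set: G] (adj u).
Proof. exact: group_vN_adj (@group_closedT G) uG. Qed.
Let uaK x : u (adj u x) = x.
Proof. by have [_ h] := uu; exact: (congr1 (@^~ x) h). Qed.
Let uKa x : adj u (u x) = x.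
Proof. by have [h _] := uu; exact: (congr1 (@^~ x) h). Qed.

(** The conjugate of [lambda R h] by [u] lies in L(H), and right cosets are stable under left
    multiplication by [H]. *)
Lemma normalizer_restrict g h x : H h ->
  restrict (right_coset g) (u (lambda R h (adj u x))) =
  u (lambda R h (adj u (restrict (right_coset g) x))).
Proof.
move=> Hh; have sH : group_vN R H (u \o lambda R h \o adj u).
  have [_ _ H3] := uN; apply: H3; exists (lambda R h) => //.
  exact: lambda_in_vN.
have := group_vN_restrict x H_subgroup (@right_coset_mull g) sH.
by move=> /= ->.
Qed.

(** On [delta R 1] left translation by [h] agrees with right translation, and the latter commutes
    with [u]. *)
Lemma normalizer_delta h : u (lambda R h (adj u xi)) = rho h^-1%g xi.
Proof. by rewrite /xi uKa lambda_delta mulg1 -group_vN_rho// rho_delta invgK mul1g. Qed.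

Lemma norm2_right_coset g h : H h ->
  norm2 (restrict (right_coset (g * h)%g) xi) = norm2 (restrict (right_coset g) xi).
Proof.
have [_ _ HV] := subgroupP H_subgroup.
(* The unitary [u \o lambda R h^-1 \o adj u] preserves norms and carries the part of [xi] on the
   coset of [g] to a right translate of the part on the coset of [g * h]. *)
move=> /HV Hh; rewrite -[RHS](norm2_unitary _ (bounded_adj bu) (unitary_adj bu uu)).
rewrite -[RHS](norm2_lambda h^-1%g) -[RHS](norm2_unitary _ bu uu).
rewrite -normalizer_restrict// normalizer_delta invgK restrict_rho norm2_rho.
suff -> : right_coset (g * h)%g = [set t | right_coset g (t * h^-1)%g] by [].
by apply/seteqP; split=> t; rewrite /right_coset /= invgM mulgA.
Qed.

(** All these cosets carry the same positive mass of [xi]. A truncation of [xi] with error below the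
    norm of that part must have a point in each of them. *)
Lemma finitely_many_right_cosets g : xi g != 0 ->
  exists F : seq G, forall h, H h -> exists2 f, f \in F & right_coset (g * h)%g f.
Proof.
move=> xg; have ag : 0 < norm2 (restrict (right_coset g) xi).
  apply: lt_le_trans (normc_le_norm2 _ g).
  rewrite restrictE mem_set; last exact: right_coset_id.
  rewrite lt_def normc_ge0 andbT; apply: contra xg => /eqP.
  by move=> /Normc.eq0_normc ->.
have [F uF HF] := trunc_approx xi ag; exists F => h Hh.
apply: contrapT => noF; move: HF; apply/negP; rewrite -leNgt.
rewrite -(norm2_right_coset g Hh).
have -> : restrict (right_coset (g * h)%g) xi =
    restrict (right_coset (g * h)%g) (xi - finite_comb F xi).
  apply: ell2P => t; rewrite !restrictE; case: ifPn => // /set_mem tK.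
  rewrite ell2BE finite_combE//; case: ifPn => tF; last by rewrite subr0.
  by case: noF; exists t.
exact: norm2_restrict.
Qed.

(** The condition on [h] says that right multiplication by [h] preserves the coset of [g]. The
    restriction then commutes with [rho h^-1], so left translation by [h] acts on the vector as
    [rho h^-1]. *)
Lemma coset_conj_invariant g h t : H h -> H (g * h * g^-1)%g ->
  adj u (restrict (right_coset g) xi) (h * t * h^-1)%g =
  adj u (restrict (right_coset g) xi) t.
Proof.
move=> Hh Hgh; set eta := adj u _.
have [_ _ HV] := subgroupP H_subgroup.
have E : lambda R h eta = rho h^-1%g eta.
  rewrite -(uKa (lambda R h eta)) /eta -normalizer_restrict// normalizer_delta.
  rewrite restrict_rho group_vN_rho//.
  suff -> : [set s | right_coset g (s * h^-1^-1)%g] = right_coset g by [].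
  rewrite -[RHS](@right_coset_eq (g * h^-1)%g g).
    by apply/seteqP; split=> s; rewrite /right_coset /= invgM mulgA.
  by have := HV _ Hgh; rewrite !invgM invgK mulgA.
have := congr1 (fun x : ell2 R G => x (h * t)%g) E.
by rewrite /= mulKg => ->.
Qed.

Hypothesis infinite_classes :
  forall t, t <> 1%g -> infinite_set [set h * t * h^-1 | h in H]%g.

(* Only finitely many cosets [H g h] occur, so [H0 = H `&` g^-1 H g] has finite
   index in [H] and infinite [H]-classes contain infinite [H0]-classes. *)
Lemma coset_vector_support g t : xi g != 0 -> t <> 1%g ->
  adj u (restrict (right_coset g) xi) t = 0.
Proof.
move=> xg t1; set eta := adj u _.
have [_ HM HV] := subgroupP H_subgroup.
apply/eqP; apply: contraT => eta0; case: (infinite_classes t1).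
have [L HL] := finite_value_set eta eta0.
have [F HF] := finitely_many_right_cosets xg.
(* [c f] is an element of [H] whose inverse moves the coset of [g] to the one through [f]; the
   default 1 only occurs for an [f] in no such coset. The class of [t] is covered by conjugating the
   finite list [L] by the finitely many [c f]. *)
pose c f := xget 1%g [set h | H h /\ right_coset (g * h^-1)%g f].
apply: (@sub_finite_set _ _ [set (c p.1 * p.2 * (c p.1)^-1)%g |
    p in [set` F] `*` [set` L]]); last first.
  by apply: finite_image; apply: finite_setX; exact: finite_seq.
move=> _ [h Hh <-]; have [f fF fh] := HF _ (HV _ Hh).
have [Hc fc] : H (c f) /\ right_coset (g * (c f)^-1)%g f.
  by apply: (@xgetPex _ 1%g [set h | H h /\ right_coset (g * h^-1)%g f]); exists h.
(* Both [g * (c f)^-1] and [g * h^-1] have [f] in their coset, so [g * k * g^-1] lies in [H] and the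
   vector has the same value at [k * t * k^-1] as at [t]. *)
pose k := ((c f)^-1 * h)%g.
have Hk : H k by apply: HM => //; exact: HV.
exists (f, (k * t * k^-1)%g); last first.
  by rewrite /= /k invgM invgK !mulgA mulgV mul1g mulgK.
split=> //=; apply: HL; apply: coset_conj_invariant => //.
by have := right_coset_meet fc fh; rewrite invgM invgK /k !mulgA.
Qed.

(** The vector [adj u p] vanishes off the identity, so applying [u] makes [p] a multiple of [xi].
    Comparing values at [g] shows that the factor is 1, hence [xi] equals its restriction. *)
Lemma support_right_coset g t : xi g != 0 -> xi t != 0 -> right_coset g t.
Proof.
move=> xg xt; set p := restrict (right_coset g) xi.
have etaE : adj u p = adj u p 1%g *: delta R 1%g.
  apply: ell2P => s; rewrite ell2ZE deltaE.
  have [->|/eqP s1] := eqVneq s 1%g; first by rewrite mulr1.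
  by rewrite coset_vector_support// mulr0.
have pE : p = adj u p 1%g *: xi.
  by rewrite -(bounded_opZ bu) -etaE uaK.
have c1 : adj u p 1%g = 1.
  have := congr1 (fun x : ell2 R G => x g) pE.
  rewrite /p restrictE mem_set; last exact: right_coset_id.
  rewrite ell2ZE -[LHS]mul1r => /(mulIf xg) <-.
  by [].
move: pE; rewrite c1 scale1r => /(congr1 (fun x : ell2 R G => x t)).
rewrite /p restrictE; case: ifPn => [/set_mem//|_ x0].
by move: xt; rewrite -x0 eqxx.
Qed.

Lemma one_sided_normalizer_decomposition :
  exists w g, [/\ group_vN R H w, unitary w,
    group_one_sided_normalizer H g & u = w \o lambda R g].
Proof.
have [H1 HM HV] := subgroupP H_subgroup.
have [g xg] : exists g, xi g != 0.
  apply: contrapT => no; have : xi = 0.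
    apply: ell2P => t; apply/eqP; apply: contrapT => /negP xt.
    by apply: no; exists t.
  move=> /(congr1 (adj u)); rewrite uKa (bounded_op0 (bounded_adj bu)).
  move=> /(congr1 (fun x : ell2 R G => x 1%g)); rewrite deltaE eqxx ell20E.
  by move/eqP; rewrite oner_eq0.
(* Removing [lambda R g] translates the support of [xi] from the coset of [g] into [H]. *)
exists (u \o lambda R g^-1%g), g; split.
- apply: group_vN_support => //.
    apply: group_vN_comp => //; first exact: group_closedT.
    by apply: lambda_in_vN => //; exact: group_closedT.
  move=> t; rewrite /= lambda_delta mulg1 group_vN_delta// invgK => xt.
  by have := support_right_coset xg xt; rewrite /right_coset /= mulgK.
- apply: unitary_comp => //; first exact: bounded_lambda.
  exact: unitary_lambda.
- move=> _ [h Hh <-].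
  (* The coset of [g * h] has the same positive mass as that of [g], so it contains a point of the
     support of [xi]. That point also lies in the coset of [g], so the two cosets meet. *)
  have [t xt] : exists t, restrict (right_coset (g * h)%g) xi t != 0.
    apply: contrapT => no; have := norm2_right_coset g Hh.
    have -> : restrict (right_coset (g * h)%g) xi = 0.
      apply: ell2P => t; apply/eqP; apply: contrapT => /negP xt.
      by apply: no; exists t.
    rewrite -[X in norm2 X = _](scale0r xi) norm2Z Normc.normc0 mul0r.
    move=> /esym/norm2_eq0/(congr1 (fun x : ell2 R G => x g)).
    rewrite restrictE mem_set; last exact: right_coset_id.
    by move=> /eqP; rewrite ell20E (negbTE xg).
  move: xt; rewrite restrictE; case: ifPn => [/set_mem tgh xt|_]; last by rewrite eqxx.
  have := right_coset_meet tgh (support_right_coset xg xt).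
  by [].
- by apply/funext => x /=; rewrite lambdaK.
Qed.

End Normalizer.

(** [lambda R k] commutes with restriction to [H]. As [delta R 1] is supported on [H], so is its
    image [delta R k]. *)
Lemma lambda_vN_mem k : group_vN R H (lambda R k) -> H k.
Proof.
move=> kH; have [H1 HM HV] := subgroupP H_subgroup.
have := group_vN_restrict (delta R 1%g) H_subgroup HM kH.
move=> /(congr1 (fun x : ell2 R G => x k)).
rewrite lambda_delta mulg1 -[LHS]/(restrict H (delta R 1%g) (k^-1 * k)%g).
rewrite mulVg !restrictE mem_set// !deltaE !eqxx.
by case: ifPn => [/set_mem//|_ /eqP]; rewrite oner_eq0.
Qed.

(** By the equality, the element [w \o lambda R h \o adj w] of L(H) is the conjugate by
    [w \o lambda R g] of some [v] in L(H). Cancelling [w] identifies [v] with left translation by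
    [g^-1 * h * g]. *)
Lemma normalizer_conj_mem w g : group_vN R H w -> unitary w ->
  conj_by (w \o lambda R g) (group_vN R H) = group_vN R H ->
  forall h, H h -> H (g^-1 * h * g)%g.
Proof.
move=> wH uw wN h Hh; have bw := group_vN_bounded H_subgroup wH.
have [w1 w2] := uw.
have := group_vN_comp H_subgroup (group_vN_comp H_subgroup wH
  (@lambda_in_vN R _ _ _ H_subgroup Hh)) (group_vN_adj H_subgroup wH).
rewrite -{1}wN => -[v vH vE]; apply: lambda_vN_mem.
rewrite (_ : lambda R _ = v)//; apply/funext => x.
have bg := bounded_lambda R g.
have := congr1 (fun f => f (w (lambda R g x))) vE.
rewrite (adj_comp bw bg) /= -[adj w (w _)]/((adj w \o w) _) w1 adj_lambda /=.
rewrite lambdaK => /(congr1 (adj w)).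
rewrite -![adj w (w _)]/((adj w \o w) _) w1 /= => /(congr1 (lambda R g^-1%g)).
by rewrite lambdaK !lambdaM => ->.
Qed.

End Irreducible.

Theorem theorem6p2 (R : realType) (G : groupType) (H : set G)
    (G_countable : countable [set: G])
    (H_subgroup : group_closed [in H])
    (G_icc : icc G)
    (H_irreducible :
       commutant (group_vN R H) `&` group_vN R [set: G] = @scalar_ops R G) :
  (forall u, one_sided_normalizer (group_vN R [set: G]) (group_vN R H) u ->
     exists w g, [/\ group_vN R H w, unitary w,
       group_one_sided_normalizer H g & u = w \o lambda R g]) /\
  (forall u, normalizer (group_vN R [set: G]) (group_vN R H) u ->
     exists w g, [/\ group_vN R H w, unitary w,
       group_normalizer H g & u = w \o lambda R g]).
Proof.
have inf := irreducible_infinite_classes H_subgroup H_irreducible.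
split=> u uN; first exact: one_sided_normalizer_decomposition.
have [uG uu uE] := uN.
have uN1 : one_sided_normalizer (group_vN R [set: G]) (group_vN R H) u.
  by split=> //; rewrite uE.
have [w [g [wH uw gN uwg]]] := one_sided_normalizer_decomposition H_subgroup uN1 inf.
exists w, g; split=> //; apply/seteqP; split=> //.
move=> h Hh; exists (g^-1 * h * g)%g; last by rewrite !mulgA mulgV mul1g mulgK.
have wN : conj_by (w \o lambda R g) (group_vN R H) = group_vN R H by rewrite -uwg.
exact: (normalizer_conj_mem H_subgroup wH uw wN Hh).
Qed.
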